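(* There exists a lattice $M$ in the variety $\mathcal{M}_{3,3}$ such that the canonical embedding $M\to\mathrm{Id}\,M$, $x\mapsto\{y\in M: y\leq x\}$, is not pure.
   Context: $\mathsf{M}_{3,3}$ is the eight-element modular lattice $\{0,u,v_0,v_1,v,u_0,u_1,1\}$ obtained by gluing two copies of $\mathsf{M}_3$ along a prime interval: $\{0,u,v_0,v_1,v\}$ is an $\mathsf{M}_3$ with bottom $0$, atoms $u,v_0,v_1$ and top $v$, and $\{u,v,u_0,u_1,1\}$ is an $\mathsf{M}_3$ with bottom $u$, atoms $v,u_0,u_1$ and top $1$. $\mathcal{M}_{3,3}$ is the lattice variety generated by $\mathsf{M}_{3,3}$. An ideal of a lattice $M$ is a nonempty subset $I$ with $x\vee y\in I$ iff $x,y\in I$; $\mathrm{Id}\,M$ is the lattice of ideals under inclusion. A subalgebra $A$ of an algebra $B$ is pure in $B$ if every finite system of equations with parameters from $A$ that has a solution in $B$ also has a solution in $A$; an embedding $f\colon A\to B$ is pure if $f[A]$ is a pure subalgebra of $B$. *)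

(* Defs.v *)
From HB Require Import structures.
From mathcomp Require Import all_boot all_order.
From mathcomp Require Import boolp classical_sets.

Set Implicit Arguments.
Unset Strict Implicit.
Unset Printing Implicit Defensive.

Import Order.LTheory.

Local Open Scope classical_set_scope.
Local Open Scope order_scope.

Inductive lterm (X : Type) : Type :=
| Var of X
| Meet of lterm X & lterm X
| Join of lterm X & lterm X.

Fixpoint eval d (L : latticeType d) (X : Type) (v : X -> L) (t : lterm X) : L :=
  match t with
  | Var x => v x
  | Meet s t => Order.meet (eval v s) (eval v t)
  | Join s t => Order.join (eval v s) (eval v t)
  end.

Definition equation (X : Type) : Type := (lterm X * lterm X)%type.

Definition satisfies d (L : latticeType d) (e : equation nat) : Prop :=
  forall v : nat -> L, eval v e.1 = eval v e.2.

Definition is_model d (L : latticeType d) (S : set (equation nat)) : Prop :=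
  forall e, S e -> satisfies L e.

(* A variety is the class of all models of some set S of identities; L lies in
   the variety generated by K when it lies in every variety containing K. *)
Definition in_variety_generated_by d (K : latticeType d) d' (L : latticeType d')
    : Prop :=
  forall S : set (equation nat), is_model K S -> is_model L S.

Section Purity.
Variables (d : Order.disp_t) (B : latticeType d).

(* An equation with parameters from A has symbols in nat + A: inl n is the n-th
   unknown, and inr a is the parameter a. *)
Definition assign (A : set B) (v : nat -> B) (x : nat + A) : B :=
  match x with inl n => v n | inr a => val a end.

Definition solves (A : set B) (E : seq (equation (nat + A))) (v : nat -> B)
    : bool :=
  all (fun e => eval (assign v) e.1 == eval (assign v) e.2) E.

Definition pure (A : set B) : Prop :=
  forall E : seq (equation (nat + A)),
    (exists v : nat -> B, solves E v) ->
    exists v : nat -> B, (forall n, A (v n)) /\ solves E v.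

End Purity.

(* f is presupposed to be injective; principal_inj below proves this for the
   canonical map into the lattice of ideals. *)
Definition pure_embedding d (A : latticeType d) d' (B : latticeType d')
    (f : {lmorphism A -> B}) : Prop :=
  pure (range f).

Section Ideals.
Variables (d : Order.disp_t) (M : latticeType d).

Definition is_ideal (I : set M) : Prop :=
  I !=set0 /\ forall x y, I (Order.join x y) <-> I x /\ I y.

Record ideal : Type := Ideal {
  ideal_set :> set M;
  ideal_setP : `[< is_ideal ideal_set >]
}.

HB.instance Definition _ := [isSub for ideal_set].
HB.instance Definition _ := [Choice of ideal by <:].

Definition ideal_le (I J : ideal) : bool := `[< I `<=` J >].

Lemma ideal_le_refl : reflexive ideal_le.
Proof. by move=> I; apply/asboolP. Qed.

Lemma ideal_le_anti : antisymmetric ideal_le.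
Proof.
by move=> I J /andP[/asboolP IJ /asboolP JI]; apply/val_inj/seteqP.
Qed.

Lemma ideal_le_trans : transitive ideal_le.
Proof.
by move=> J I K /asboolP IJ /asboolP JK; apply/asboolP/(subset_trans IJ).
Qed.

HB.instance Definition _ :=
  Order.Le_isPOrder.Build d ideal ideal_le_refl ideal_le_anti ideal_le_trans.

Lemma idealE (I : ideal) : is_ideal I.
Proof. exact/asboolP/(ideal_setP I). Qed.

Lemma ideal_neq0 (I : ideal) : I !=set0.
Proof. by case: (idealE I). Qed.

Lemma idealU (I : ideal) x y :
  ideal_set I (Order.join x y) <-> ideal_set I x /\ ideal_set I y.
Proof. by case: (idealE I). Qed.

Lemma ideal_down (I : ideal) x y : x <= y -> ideal_set I y -> ideal_set I x.
Proof. by move=> /join_idPl<- /idealU[]. Qed.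

Lemma ideal_meet_subproof (I J : ideal) : `[< is_ideal (I `&` J) >].
Proof.
apply/asboolP; split.
  have [[x Ix] [y Jy]] := (ideal_neq0 I, ideal_neq0 J).
  by exists (Order.meet x y); split;
    [exact: (ideal_down (leIl _ _) Ix) | exact: (ideal_down (leIr _ _) Jy)].
move=> x y; split=> [[/idealU[? ?] /idealU[? ?]]//|[[? ?] [? ?]]].
by split; apply/idealU.
Qed.

Definition ideal_meet (I J : ideal) : ideal := Ideal (ideal_meet_subproof I J).

Lemma ideal_join_subproof (I J : ideal) :
  `[< is_ideal [set z | exists x y,
        [/\ ideal_set I x, ideal_set J y & z <= Order.join x y]] >].
Proof.
apply/asboolP; split.
  have [[x Ix] [y Jy]] := (ideal_neq0 I, ideal_neq0 J).
  by exists (Order.join x y), x, y.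
move=> z t; split=> [[x [y [Ix Jy]]]|].
  by rewrite leUx => /andP[? ?]; split; exists x, y.
move=> [[x [y [Ix Jy zxy]]] [x' [y' [Ix' Jy' txy]]]].
exists (Order.join x x'), (Order.join y y'); split; [exact/idealU|exact/idealU|].
by rewrite joinACA leU2.
Qed.

Definition ideal_join (I J : ideal) : ideal := Ideal (ideal_join_subproof I J).

Lemma ideal_meetP (I J K : ideal) :
  (I <= ideal_meet J K) = (I <= J) && (I <= K).
Proof.
apply/asboolP/andP => [IJK|[/asboolP IJ /asboolP IK] x Ix].
  by split; apply/asboolP => x /IJK[].
by split; [exact: IJ | exact: IK].
Qed.

Lemma ideal_joinP (I J K : ideal) :
  (ideal_join I J <= K) = (I <= K) && (J <= K).
Proof.
apply/asboolP/andP => [IJK|[/asboolP IK /asboolP JK] z [x [y [Ix Jy zxy]]]].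
  have [[x Ix] [y Jy]] := (ideal_neq0 I, ideal_neq0 J).
  split; apply/asboolP => z Iz; apply: IJK.
    by exists z, y; split=> //; exact: leUl.
  by exists x, z; split=> //; exact: leUr.
by apply: (ideal_down zxy); apply/idealU; split; [exact: IK | exact: JK].
Qed.

HB.instance Definition _ :=
  Order.POrder_MeetJoin_isLattice.Build d ideal ideal_meetP ideal_joinP.

Lemma principal_subproof (x : M) : `[< is_ideal [set y | y <= x] >].
Proof.
apply/asboolP; split; first by exists x => /=.
by move=> y z /=; rewrite leUx; split=> /andP.
Qed.

Definition principal (x : M) : ideal := Ideal (principal_subproof x).

Lemma principal_mono : {mono principal : x y / x <= y}.
Proof.
move=> x y; apply/asboolP/idP => [xy|xy z /= zx]; first exact: (xy x (lexx x)).
exact: le_trans xy.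
Qed.

Lemma principal_inj : injective principal.
Proof. by move=> x y xy; apply: le_anti; rewrite -!principal_mono xy lexx. Qed.

Lemma principal_homo : {homo principal : x y / x <= y}.
Proof. by move=> x y; rewrite principal_mono. Qed.

Lemma principalI : {morph principal : x y / Order.meet x y}.
Proof.
move=> x y; apply/val_inj/seteqP.
by split=> z /=; rewrite lexI => /andP.
Qed.

Lemma principalU : {morph principal : x y / Order.join x y}.
Proof.
move=> x y; apply/val_inj/seteqP; split=> z /=; first by exists x, y.
by move=> [x' [y' [xx' yy' zxy]]]; apply: le_trans zxy _; rewrite leU2.
Qed.

HB.instance Definition _ :=
  Order.isOrderMorphism.Build d M d ideal principal principal_homo.
HB.instance Definition _ :=
  Order.isLatticeMorphism.Build d M d ideal principal principalI principalU.

End Ideals.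

Inductive M33 : predArgType :=
  m33_0 | m33_u | m33_v0 | m33_v1 | m33_v | m33_u0 | m33_u1 | m33_1.

Definition m33_enum : seq M33 :=
  [:: m33_0; m33_u; m33_v0; m33_v1; m33_v; m33_u0; m33_u1; m33_1].

Definition m33_code (x : M33) : nat :=
  match x with
  | m33_0 => 0 | m33_u => 1 | m33_v0 => 2 | m33_v1 => 3
  | m33_v => 4 | m33_u0 => 5 | m33_u1 => 6 | m33_1 => 7
  end.

Lemma m33_codeK : cancel m33_code (nth m33_0 m33_enum).
Proof. by case. Qed.

HB.instance Definition _ := Countable.copy M33 (can_type m33_codeK).

Lemma m33_enumP : Finite.axiom m33_enum.
Proof. by case. Qed.

HB.instance Definition _ := isFinite.Build M33 m33_enumP.

Definition m33_le (x y : M33) : bool :=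
  match x, y with
  | m33_0, _ | _, m33_1 => true
  | (m33_u | m33_v0 | m33_v1), m33_v => true
  | m33_u, (m33_u0 | m33_u1) => true
  | _, _ => x == y
  end.

(* Incomparable elements x, y have meet u if both lie above u, and meet 0
   otherwise; dually with v for joins. *)
Definition m33_meet (x y : M33) : M33 :=
  if m33_le x y then x else if m33_le y x then y else
  if m33_le m33_u x && m33_le m33_u y then m33_u else m33_0.

Definition m33_join (x y : M33) : M33 :=
  if m33_le x y then y else if m33_le y x then x else
  if m33_le x m33_v && m33_le y m33_v then m33_v else m33_1.

Lemma m33_le_refl : reflexive m33_le.
Proof. by case. Qed.

Lemma m33_le_anti : antisymmetric m33_le.
Proof. by do 2 case. Qed.

Lemma m33_le_trans : transitive m33_le.
Proof. by do 3 case. Qed.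

HB.instance Definition _ :=
  Order.Le_isPOrder.Build (Order.Disp tt tt) M33
    m33_le_refl m33_le_anti m33_le_trans.

Lemma m33_meetP (x y z : M33) : (x <= m33_meet y z) = (x <= y) && (x <= z).
Proof. by case: x; case: y; case: z. Qed.

Lemma m33_joinP (x y z : M33) : (m33_join x y <= z) = (x <= z) && (y <= z).
Proof. by case: x; case: y; case: z. Qed.

HB.instance Definition _ :=
  Order.POrder_MeetJoin_isLattice.Build (Order.Disp tt tt) M33
    m33_meetP m33_joinP.

(* Main.v *)
Require Import Defs.
From mathcomp Require Import all_boot all_order.
From HB Require Import structures.
From mathcomp Require Import boolp classical_sets.

(** Let [R] relate [x <= y] in M33 when both lie in [[0, v]] or both lie in
    [[u, 1]]; it is a sublattice of M33 x M33 which omits [(0, 1)], although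
    [R \o R] contains it.  Take for [M] the sequences that decrease along [R],
    with one more coordinate which is [1] unless the sequence is eventually [0].
    The equations [x /\ v = (x /\ v0) \/ (x /\ v1)] and
    [x \/ u = (x \/ u0) /\ (x \/ u1)] have exactly the solutions [0] and [1] in
    M33, so a solution of them in [M] is a constant sequence.  Two further
    equations force it to start at [1] and to be eventually [0].  In the ideal
    lattice the sequences [1, ..., 1, v, 0, 0, ...] generate an ideal that looks
    like [1] at every finite place and like [0] at infinity, and it solves the
    system. *)

Set Implicit Arguments.
Unset Strict Implicit.
Unset Printing Implicit Defensive.

Import Order.LTheory.

Local Open Scope classical_set_scope.
Local Open Scope order_scope.

(** * The relation [R] and the lattice of sequences decreasing along it *)

Definition same_block (x y : M33) : bool :=
  (x <= y) && ((y <= m33_v) || (m33_u <= x)).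

Lemma same_blockI x x' y y' : same_block x y -> same_block x' y' ->
  same_block (Order.meet x x') (Order.meet y y').
Proof. by case: x; case: y => //; case: x'; case: y'. Qed.

Lemma same_blockU x x' y y' : same_block x y -> same_block x' y' ->
  same_block (Order.join x x') (Order.join y y').
Proof. by case: x; case: y => //; case: x'; case: y'. Qed.

Lemma same_block_refl x : same_block x x.
Proof. by case: x. Qed.

Definition eventually0 (f : nat -> M33) : Prop :=
  exists N, forall n, (N <= n)%N -> f n.+1 = m33_0.

Definition admissible (f : nat -> M33) : Prop :=
  (forall n, same_block (f n.+2) (f n.+1)) /\ (f 0%N = m33_1 \/ eventually0 f).

(* The sequence proper is [n |-> f n.+1]; coordinate [0] is the extra one. *)
Record bseq : Type := Bseq {
  bseq_val :> nat -> M33;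
  bseq_valP : `[< admissible bseq_val >]
}.

HB.instance Definition _ := [isSub for bseq_val].
HB.instance Definition _ := [Choice of bseq by <:].

Definition bseq_le (f g : bseq) : bool := `[< forall n, f n <= g n >].

Lemma bseq_le_refl : reflexive bseq_le.
Proof. by move=> f; apply/asboolP. Qed.

Lemma bseq_le_anti : antisymmetric bseq_le.
Proof.
move=> f g /andP[/asboolP fg /asboolP gf]; apply/val_inj/funext => n.
by apply: le_anti; rewrite fg gf.
Qed.

Lemma bseq_le_trans : transitive bseq_le.
Proof.
by move=> g f h /asboolP fg /asboolP gh; apply/asboolP => n; apply: le_trans (gh n).
Qed.

HB.instance Definition _ := Order.Le_isPOrder.Build (Order.Disp tt tt) bseq
  bseq_le_refl bseq_le_anti bseq_le_trans.

Lemma bseqP (f : bseq) : admissible f.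
Proof. exact/asboolP/(bseq_valP f). Qed.

Lemma meet0m33 (x : M33) : Order.meet m33_0 x = m33_0. Proof. by case: x. Qed.
Lemma meetm330 (x : M33) : Order.meet x m33_0 = m33_0. Proof. by case: x. Qed.
Lemma join1m33 (x : M33) : Order.join m33_1 x = m33_1. Proof. by case: x. Qed.
Lemma joinm331 (x : M33) : Order.join x m33_1 = m33_1. Proof. by case: x. Qed.

(** One eventually zero factor makes the meet eventually zero; otherwise both extra coordinates are
    [m33_1]. For joins the two alternatives exchange roles. *)
Lemma bseq_meet_subproof (f g : bseq) :
  `[< admissible (fun n => Order.meet (f n) (g n)) >].
Proof.
have [[fR f0] [gR g0]] := (bseqP f, bseqP g).
apply/asboolP; split=> [n|]; first exact: same_blockI.
case: f0 => [f1|[N fN]]; last by right; exists N => n /fN ->; exact: meet0m33.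
case: g0 => [g1|[N gN]]; last by right; exists N => n /gN ->; exact: meetm330.
by left; rewrite f1 g1.
Qed.

Lemma bseq_join_subproof (f g : bseq) :
  `[< admissible (fun n => Order.join (f n) (g n)) >].
Proof.
have [[fR f0] [gR g0]] := (bseqP f, bseqP g).
apply/asboolP; split=> [n|]; first exact: same_blockU.
case: f0 => [->|[N fN]]; first by left; exact: join1m33.
case: g0 => [->|[N' gN]]; first by left; exact: joinm331.
by right; exists (maxn N N') => n; rewrite geq_max => /andP[/fN -> /gN ->].
Qed.

Definition bseq_meet (f g : bseq) : bseq := Bseq (bseq_meet_subproof f g).
Definition bseq_join (f g : bseq) : bseq := Bseq (bseq_join_subproof f g).

Lemma bseq_meetP (f g h : bseq) :
  (f <= bseq_meet g h) = (f <= g) && (f <= h).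
Proof.
apply/asboolP/andP => [fgh|[/asboolP fg /asboolP fh] n]; last first.
  by rewrite /= lexI fg fh.
by split; apply/asboolP => n; have := fgh n; rewrite /= lexI => /andP[].
Qed.

Lemma bseq_joinP (f g h : bseq) :
  (bseq_join f g <= h) = (f <= h) && (g <= h).
Proof.
apply/asboolP/andP => [fgh|[/asboolP fh /asboolP gh] n]; last first.
  by rewrite /= leUx fh gh.
by split; apply/asboolP => n; have := fgh n; rewrite /= leUx => /andP[].
Qed.

HB.instance Definition _ :=
  Order.POrder_MeetJoin_isLattice.Build (Order.Disp tt tt) bseq
    bseq_meetP bseq_joinP.

Lemma bseq_leP (f g : bseq) : reflect (forall n, f n <= g n) (f <= g).
Proof. exact: asboolP. Qed.

Lemma bseq_meetE (f g : bseq) n : Order.meet f g n = Order.meet (f n) (g n).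
Proof. by []. Qed.

Lemma bseq_joinE (f g : bseq) n : Order.join f g n = Order.join (f n) (g n).
Proof. by []. Qed.

Lemma bseq_eval (X : Type) (v : X -> bseq) (t : lterm X) n :
  eval v t n = eval (fun i => v i n) t.
Proof. by elim: t => //= s <- t <-. Qed.

(** [bseq] is a sublattice of a power of [M33], so identities pass to it coordinatewise. *)
Lemma bseq_variety : in_variety_generated_by M33 bseq.
Proof.
move=> S K e Se v; apply/val_inj/funext => n.
by rewrite /= !bseq_eval; exact: K.
Qed.

(* The value [1] at the extra coordinate makes every constant admissible. *)
Lemma const_subproof (c : M33) :
  `[< admissible (fun n => if n is _.+1 then c else m33_1) >].
Proof. by apply/asboolP; split=> [n|]; [exact: same_block_refl | left]. Qed.

Definition const (c : M33) : bseq := Bseq (const_subproof c).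

(** The single term [d] is a landing between [c] and zero: [m33_1] cannot drop to [m33_0] in one
    step along [R], but it can through [m33_v]. *)
Definition step_fun (c d : M33) (N n : nat) : M33 :=
  if n is m.+1 then if (m < N)%N then c else if (m == N)%N then d else m33_0
  else m33_0.

Lemma step_subproof (c d : M33) (N : nat) :
  same_block d c -> same_block m33_0 d -> `[< admissible (step_fun c d N) >].
Proof.
move=> dc d0; apply/asboolP; split=> [n|].
  rewrite /=; have [_|_|//] := ltngtP n.+1 N; first exact: same_block_refl.
  by case: eqP.
right; exists N.+1 => n Nn; rewrite /= ltnNge (ltnW Nn) /=.
by rewrite gtn_eqF.
Qed.

Definition step (c d : M33) N (dc : same_block d c) (d0 : same_block m33_0 d) :
  bseq := Bseq (step_subproof N dc d0).

Lemma vanishing_subproof : `[< is_ideal [set f : bseq | f 0%N = m33_0] >].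
Proof.
apply/asboolP; split; first by exists (@step m33_0 m33_0 0%N isT isT).
move=> f g /=.
by case: (f 0%N); case: (g 0%N); split=> // -[].
Qed.

(** An element with extra coordinate [m33_0] is eventually zero, hence below some
    [1, ..., 1, v, 0, 0, ...] with the same extra coordinate; these sequences generate the ideal. *)
Definition vanishing : ideal bseq := Ideal vanishing_subproof.

Lemma vanishing_eventually0 (f : bseq) : f 0%N = m33_0 -> eventually0 f.
Proof. by move=> f0; have [_ []] := bseqP f; rewrite ?f0. Qed.

(** The first equation rules out [m33_u], [m33_u0] and [m33_u1]; the second rules out [m33_v0],
    [m33_v1] and [m33_v]. *)
Lemma zero_or_one (x : M33) :
  Order.meet x m33_v = Order.join (Order.meet x m33_v0) (Order.meet x m33_v1) ->
  Order.join x m33_u = Order.meet (Order.join x m33_u0) (Order.join x m33_u1) ->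
  x = m33_0 \/ x = m33_1.
Proof. by case: x => //; [left | right]. Qed.

Lemma const_homo : {homo const : c d / c <= d}.
Proof. by move=> c d cd; apply/bseq_leP => -[]. Qed.

(** The sequence [1, v, 0, 0, ...]: a member of [vanishing] whose first term is [m33_1]. *)
Definition ones : bseq := @step m33_1 m33_v 1 isT isT.
(** The bottom of [bseq]; it differs from [const m33_0] exactly at the extra coordinate. *)
Definition zero : bseq := @step m33_0 m33_0 0 isT isT.

Local Notation "↓ f" := (principal f) (at level 0, f at level 0).

Lemma vanishing_meet_v : Order.meet vanishing ↓(const m33_v) =
  Order.join (Order.meet vanishing ↓(const m33_v0))
             (Order.meet vanishing ↓(const m33_v1)).
Proof.
apply/le_anti/andP; split; last by rewrite leUx !leI2 ?principal_mono ?const_homo.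
apply/asboolP => f [f0 /bseq_leP fv]; have [N fN] := vanishing_eventually0 f0.
(* Both atoms may drop straight to [m33_0]. Their join [m33_v] bounds [f] on the first [N] terms,
   after which [f] is zero. *)
exists (@step m33_v0 m33_0 N isT isT), (@step m33_v1 m33_0 N isT isT).
split; [split=> //; apply/bseq_leP|split=> //; apply/bseq_leP|apply/bseq_leP].
- by case=> //= n; case: ifP => // _; case: ifP.
- by case=> //= n; case: ifP => // _; case: ifP.
case=> [|n]; rewrite bseq_joinE; first by rewrite f0.
rewrite /=; case: ltnP => [_|/fN -> //]; exact: (fv n.+1).
Qed.

Lemma vanishing_join_u : Order.join vanishing ↓(const m33_u) =
  Order.meet (Order.join vanishing ↓(const m33_u0))
             (Order.join vanishing ↓(const m33_u1)).
Proof.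
apply/le_anti/andP; split; first by rewrite lexI !leU2 ?principal_mono ?const_homo.
apply/asboolP => z [[f [f' [f0 /bseq_leP f'u /bseq_leP zf]]]].
move=> [g [g' [g0 /bseq_leP g'u /bseq_leP zg]]].
have [[N fN] [N' gN]] := (vanishing_eventually0 f0, vanishing_eventually0 g0).
(* The first [maxn N N'] terms are bounded by [m33_1]. After them [f] and [g] are zero, so [z] lies
   below both [m33_u0] and [m33_u1], hence below [m33_u]. *)
exists (@step m33_1 m33_v (maxn N N') isT isT), (const m33_u).
split=> //; first exact: lexx.
apply/bseq_leP => -[|n]; rewrite bseq_joinE /=; first by case: (z 0%N).
case: ltnP => [_|]; first by case: (z n.+1).
rewrite geq_max => /andP[/fN fn0 /gN gn0].
have := zf n.+1; have := zg n.+1; have := f'u n.+1; have := g'u n.+1.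
rewrite !bseq_joinE fn0 gn0 /=.
by case: (f' n.+1) => //; case: (g' n.+1) => //; case: (z n.+1) => //; case: ifP.
Qed.

Lemma zeroE n : zero n = m33_0.
Proof. by case: n => [|[|n]]. Qed.

Lemma vanishing_meet_0 : Order.meet vanishing ↓(const m33_0) = ↓zero.
Proof.
apply/le_anti/andP; split; apply/asboolP => f.
  move=> [f0 /bseq_leP fle]; apply/bseq_leP => n; rewrite zeroE.
  by case: n => [|n]; [rewrite f0 | exact: (fle n.+1)].
move=> /bseq_leP fz; have {}fz n : f n = m33_0.
  by have := fz n; rewrite zeroE; case: (f n).
by split; [exact: fz | apply/bseq_leP => n; rewrite fz].
Qed.

Lemma vanishing_ones : Order.meet vanishing ↓ones = ↓ones.
Proof.
by apply/meet_idPr/asboolP => f /bseq_leP /(_ 0%N) /=; case: (f 0%N).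
Qed.

(** * The system of equations and its solutions among ideals *)

Definition par (f : bseq) : lterm (nat + range (@principal _ bseq)) :=
  Var (inr (SigSub (mem_set (imageP (@principal _ bseq) (I : setT f))))).

Definition unk : lterm (nat + range (@principal _ bseq)) := Var (inl 0%N).

(* The third equation forces [x 0 = 0], hence [x] is eventually [0]; the fourth
   one forces [x 1 = 1]. *)
Definition system : seq (equation (nat + range (@principal _ bseq))) :=
  [:: (Meet unk (par (const m33_v)),
       Join (Meet unk (par (const m33_v0))) (Meet unk (par (const m33_v1))));
      (Join unk (par (const m33_u)),
       Meet (Join unk (par (const m33_u0))) (Join unk (par (const m33_u1))));
      (Meet unk (par (const m33_0)), par zero);
      (Meet unk (par ones), par ones)].

Lemma system_vanishing : solves system (fun=> vanishing).
Proof.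
apply/and5P; split=> //; apply/eqP.
- exact: vanishing_meet_v.
- exact: vanishing_join_u.
- exact: vanishing_meet_0.
- exact: vanishing_ones.
Qed.

Lemma system_principal (f : bseq) (v : nat -> ideal bseq) :
  v 0%N = ↓f -> ~ solves system v.
Proof.
move=> vf /and5P[/eqP ev /eqP eu /eqP e0 /eqP e1 _]; move: ev eu e0 e1.
(* Since [principal] is an injective lattice morphism, the equations pull back to [bseq], where they
   are read coordinatewise. *)
rewrite /= vf -!principalI -!principalU -!principalI.
move=> /principal_inj ev /principal_inj eu /principal_inj e0 /principal_inj e1.
have f01 n : f n.+1 = m33_0 \/ f n.+1 = m33_1.
  apply: zero_or_one.
    exact: (congr1 (fun g : bseq => g n.+1) ev).
  exact: (congr1 (fun g : bseq => g n.+1) eu).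
have f0 : f 0%N = m33_0.
  by have := congr1 (fun g : bseq => g 0%N) e0; rewrite bseq_meetE /=; case: (f 0%N).
have f1 n : f n.+1 = m33_1.
  elim: n => [|n IHn].
    by have := congr1 (fun g : bseq => g 1%N) e1; rewrite bseq_meetE /=; case: (f 1%N).
  (* After a term [m33_1] the value [m33_0] is impossible, as [R] omits that pair. *)
  by have [/(_ n)] := bseqP f; rewrite IHn; case: (f01 n.+1) => ->.
by have [N /(_ N (leqnn N))] := vanishing_eventually0 f0; rewrite f1.
Qed.

Theorem theorem5p5 :
  exists (d : Order.disp_t) (M : latticeType d),
    in_variety_generated_by M33 M /\ ~ pure_embedding (@principal d M).
Proof.
exists _, bseq; split; first exact: bseq_variety.
move=> /(_ system) [|v [vP]]; first by exists (fun=> vanishing); exact: system_vanishing.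
have [f _ /esym] := vP 0%N; exact: system_principal.
Qed.
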